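(* Let $p$ be a prime, $t\ge 1$ an integer, and $K\ge 2$ an integer. Then: (A) If $n\ge K$, then \[\Phi(n,K,p^t)\le p^{t-1}\left\lfloor \mu_p\left(n-K+1-\left\lfloor\frac{n-K+1}{p+1}\right\rfloor\right)\right\rfloor.\] (B) If $K\ge p$ and $n>K+1$, or if $2\le K\le p$ and $n>p+1$, then \[\Phi(n,K,p^t)\le p^{t-1}\left\lfloor \mu_p(n-K)\right\rfloor.\] (C) If $3\le K+1\le n\le p+1$, then \[\Phi(n,K,p^t)\le p^{t-1}\left\lfloor \mu_p(n-K+1)\cdot\frac{p-1}{p}+1\right\rfloor.\] (D) If $n=K$, then $\Phi(K,K,p^t)=p^{t-1}$.
   Context: For a prime $p$ and integer $t\ge1$, a linear code of length $n$ over $\mathbb{Z}_{p^t}$ is a $\mathbb{Z}_{p^t}$-submodule $\mathcal{C}$ of $(\mathbb{Z}_{p^t})^n$. Every such code is isomorphic to $(\mathbb{Z}_{p^t})^{k_1}\times(\mathbb{Z}_{p^{t-1}})^{k_2}\times\cdots\times(\mathbb{Z}_p)^{k_t}$; its rank is $K=\sum_i k_i$. The Lee weight of $a\in\mathbb{Z}_q$ (viewed as an integer in $\{0,\dots,q-1\}$) is $w_L(a)=\min\{a,q-a\}$, the Lee weight of a vector is the sum of the Lee weights of its coordinates, and the minimum Lee distance $d_L(\mathcal{C})$ of a linear code is the minimum Lee weight of a nonzero codeword. $\mu_p$ denotes the average Lee weight of the nonzero elements of $\mathbb{Z}_p$: $\mu_p=\frac{p^2}{4(p-1)}$ if $p$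 is even (i.e. $p=2$, giving $\mu_2=1$) and $\mu_p=\frac{p+1}{4}$ if $p$ is odd. For $n\ge K\ge1$, $\Phi(n,K,p^t)$ denotes the maximum of $d_L(\mathcal{C})$ over all linear codes $\mathcal{C}\subseteq(\mathbb{Z}_{p^t})^n$ of rank $K$. *)

(* Defs.v *)
From HB Require Import structures.
From mathcomp Require Import all_boot all_order all_algebra.
From mathcomp Require Import boolp.
From mathcomp Require Import zify ring lra.

Set Implicit Arguments.
Unset Strict Implicit.
Unset Printing Implicit Defensive.

Import Order.TTheory GRing.Theory Num.Theory.
Local Open Scope ring_scope.

(* 'Z_q is the ring of integers mod q only for 1 < q; below q is always a
   positive power of a prime. *)
Definition lee_weight (q : nat) (a : 'Z_q) : nat := minn a (q - a)%N.

Definition lee_weight_vec (q n : nat) (v : 'rV['Z_q]_n) : nat :=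
  (\sum_(j < n) lee_weight (v ord0 j))%N.

Definition linear_code (q n : nat) (C : {set 'rV['Z_q]_n}) : Prop :=
  submod_closed C.

(* The value 0 for the zero code is a placeholder. *)
Definition min_lee_distance (q n : nat) (C : {set 'rV['Z_q]_n}) : nat :=
  if [pick c in C | c != 0] is Some c0 then
    lee_weight_vec [arg min_(c < c0 | (c \in C) && (c != 0)) lee_weight_vec c]
  else 0%N.

(* The product of the (Z_{p^(t-i)})^(k i) for 0 <= i < t; k i is the k_(i+1) of
   the usual notation. *)
Definition code_model (p t : nat) (k : 'I_t -> nat) : Type :=
  forall i : 'I_t, 'rV['Z_(p ^ (t - i))]_(k i).

(* C is the image of an injective Z_{p^t}-linear map from the product above.
   A scalar a of Z_{p^t}, seen as an integer, acts on the factor Z_{p^(t-i)}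
   as multiplication by that integer, i.e. as x |-> x *+ a. *)
Definition has_type (p t n : nat) (C : {set 'rV['Z_(p ^ t)]_n})
    (k : 'I_t -> nat) : Prop :=
  exists f : code_model p k -> 'rV['Z_(p ^ t)]_n,
    [/\ forall x y, f (fun i => x i + y i) = f x + f y,
        forall (a : 'Z_(p ^ t)) x, f (fun i => x i *+ a) = a *: f x,
        injective f
      & forall v, v \in C <-> exists x, f x = v].

Definition has_rank (p t n : nat) (C : {set 'rV['Z_(p ^ t)]_n}) (K : nat) :
    Prop :=
  exists2 k : 'I_t -> nat, has_type C k & K = (\sum_(i < t) k i)%N.

(* Phi n K p t is the quantity Phi(n, K, p^t). *)
Definition Phi (n K p t : nat) : nat :=
  (\max_(C : {set 'rV['Z_(p ^ t)]_n} | `[< linear_code C /\ has_rank C K >])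
     min_lee_distance C)%N.

Definition mu (p : nat) : rat :=
  (\sum_(a : 'Z_p | a != 0%R) lee_weight a)%N%:R / (p - 1)%N%:R.

Lemma sum_minn_odd (m : nat) :
  (\sum_(0 <= i < m.*2.+1) minn i (m.*2.+1 - i) = m * m.+1)%N.
Proof.
have half : (\sum_(0 <= i < m.+1) i = \sum_(m.+1 <= i < m.*2.+1)
    (m.*2.+1 - i))%N.
  rewrite big_nat_recl // add0n [RHS](big_addn 0 _ m.+1).
  have -> : (m.*2.+1 - m.+1 = m)%N by lia.
  rewrite big_nat_rev /=; apply: eq_big_nat => i /andP[_ lt_im]; lia.
have gauss : ((\sum_(0 <= i < m.+1) i).*2 = m * m.+1)%N.
  by elim: (m) => [|k IHk]; rewrite ?big_nat1 // big_nat_recr //= doubleD IHk; lia.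
rewrite (@big_cat_nat _ _ _ m.+1) //=; last by lia.
rewrite -gauss -[RHS]addnn {2}half; congr (_ + _)%N;
  by apply: eq_big_nat => i /andP[le_mi lt_im]; lia.
Qed.

Lemma mu_closed_form (p : nat) : prime p ->
  mu p = if odd p then (p + 1)%N%:R / 4 else (p ^ 2)%N%:R / (4 * (p - 1)%N%:R).
Proof.
move=> p_pr; have p_gt1 := prime_gt1 p_pr.
have sumE : (\sum_(a : 'Z_p | a != 0%R) lee_weight a
             = \sum_(0 <= i < p) minn i (p - i))%N.
  have -> : (\sum_(0 <= i < p) minn i (p - i)
             = \sum_(0 <= i < (Zp_trunc p).+2) minn i (p - i))%N.
    by rewrite Zp_cast.
  by rewrite big_mkord [RHS](bigD1 ord0) //= min0n add0n.
rewrite /mu sumE; case: ifP => [p_odd | p_even]; last first.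
  have -> : p = 2%N by case: (even_prime p_pr) => // p_odd; rewrite p_odd in p_even.
  by rewrite big_nat_recr //= big_nat1.
have pE : p = (p./2).*2.+1 by rewrite -{1}(odd_double_half p) p_odd.
have m_gt0 : (0 < p./2)%N by lia.
move: (p./2) pE m_gt0 => m -> m_gt0; rewrite sum_minn_odd.
have m_neq0 : (m%:R : rat) != 0 by rewrite pnatr_eq0 -lt0n.
rewrite subn1 /= -muln2 -addn1 -[(m * 2).+1]addn1 !(natrM, natrD).
by field; rewrite m_neq0.
Qed.

(* Main.v *)
From HB Require Import structures.
Require Import Defs.
From mathcomp Require Import all_boot all_order all_algebra.
From mathcomp Require Import perm finfield boolp.
From mathcomp Require Import zify ring.

Set Implicit Arguments.
Unset Strict Implicit.
Unset Printing Implicit Defensive.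

Import Order.TTheory GRing.Theory Num.Theory.
Local Open Scope ring_scope.

(**
The elements of [C] killed by [p] form [p ^ (t - 1)] times a [K]-dimensional
linear code over the field with [p] elements, and this factor multiplies Lee
weights, so everything reduces to [t = 1].

The Lee weights of the nonzero multiples of a word of Hamming weight [w]
average to [mu p * w]; hence the minimum Lee distance is at most [mu p] times
the minimum Hamming distance. (A) is then the Plotkin bound for a
two-dimensional subcode vanishing at [K - 2] positions. For an MDS code, (C)
averages over the words [w0 + a w1], where [w0] and [w1] vanish at [K - 2] common
positions and take the values [1] and [0] at one further position.

(B) says that there is no MDS code of length [n > p + 1] with dimension and
codimension at least 2 (Ball). Puncturing and dualizing lead to length [p + 2]
and dimension [k <= (p + 1) / 2]. Let [E] be a set of [2 k - 3] positions and, for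
a set [C] of [k - 1] positions, let [b C] be the inverse of the product of
[det (s, C)] over all [s] outside [C] and, once more, over all [s] in [E] outside
[C]. Lagrange interpolation on a projective line shows that, for every set [A] of
[k - 2] positions of [E], the sum of [b C] over the [C] in [E] containing [A]
vanishes. As [k - 1 < p], the inclusion matrix of [(k - 2)]-sets in
[(k - 1)]-sets of [E] is invertible mod [p], which contradicts [b C <> 0].
*)

(** * Two vanishing sums: set inclusion and Lagrange interpolation *)

Section InclusionKernel.
Variables (T : finType) (F : idomainType) (E : {set T}) (k : nat).
Variable b : {set T} -> F.
Hypothesis card_E : #|E| = k.*2.+1.
Hypothesis natF_neq0 : forall i, (0 < i <= k.+1)%N -> i%:R != 0 :> F.
Hypothesis sum_b : forall A : {set T}, A \subset E -> #|A| = k ->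
  \sum_(x in E :\: A) b (x |: A) = 0.

(** Removing [x] from [C] shrinks the intersection with [D] exactly when [x] lies in [D]. So the
    elements counted are those of [C :&: D] if it has size [i + 1], and those of [C :\: D] if it has
    size [i]. *)
Lemma card_remove_meet (C D : {set T}) i : #|C| = k.+1 ->
  #|[set x in C | #|(C :\ x) :&: D| == i]| =
  ((#|C :&: D| == i.+1) * i.+1 + (#|C :&: D| == i) * (k.+1 - i))%N.
Proof.
move=> cC.
have meetE x : x \in C -> #|C :&: D| = ((x \in D) + #|(C :\ x) :&: D|)%N.
  by move=> xC; rewrite (cardsD1 x) inE xC setIDAC.
case: (eqVneq #|C :&: D| i.+1) => [e1|n1].
  rewrite e1 (gtn_eqF (ltnSn i)) mul0n addn0 mul1n -e1.
  apply: eq_card => x; rewrite !inE; case xC: (x \in C) => //=.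
  by move: (meetE x xC); rewrite e1; case: (x \in D) => /= H; apply/eqP; lia.
case: (eqVneq #|C :&: D| i) => [e0|n0].
  have -> : [set x in C | #|(C :\ x) :&: D| == i] = C :\: D.
    apply/setP=> x; rewrite !inE andbC; case xC: (x \in C); rewrite ?andbF //= !andbT.
    move: (meetE x xC); rewrite e0; case: (x \in D) => /= H; last first.
      by apply/eqP; lia.
    by apply/negbTE/eqP; lia.
  by rewrite cardsD cC e0 mul0n mul1n.
rewrite !mul0n; apply: eq_card0 => x; rewrite !inE.
case xC: (x \in C) => //=; move: (meetE x xC) n1 n0 => ->.
by case: (x \in D) => /=; lia.
Qed.

(** Sum [sum_b] over the [A] that meet [D] in [i] elements and regroup the pairs [(A, x)] by
    [C = x |: A]; [card_remove_meet] gives the multiplicity of each [b C]. *)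
Lemma layer_sum_rec (D : {set T}) i :
  let s j := \sum_(C : {set T} | (C \subset E) && (#|C| == k.+1) &&
                                 (#|C :&: D| == j)) b C in
  s i.+1 *+ i.+1 + s i *+ (k.+1 - i) = 0.
Proof.
move=> s.
have : \sum_(A : {set T} | [&& A \subset E, #|A| == k & #|A :&: D| == i])
         \sum_(x in E :\: A) b (x |: A) = 0.
  by apply: big1 => A /and3P[sA /eqP cA _]; apply: sum_b.
rewrite pair_big_dep /=.
rewrite (reindex_onto (fun q : {set T} * T => (q.1 :\ q.2, q.2))
                      (fun q => (q.2 |: q.1, q.2))) /=; last first.
  move=> [A x] /= /andP[_]; rewrite inE => /andP[xA _].
  by rewrite setU1K.
under eq_bigl => q.
  have -> : [&& [&& q.1 :\ q.2 \subset E, #|q.1 :\ q.2| == k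
                & #|(q.1 :\ q.2) :&: D| == i] && (q.2 \in E :\: (q.1 :\ q.2))
            & (q.2 |: (q.1 :\ q.2), q.2) == q] =
    ((q.1 \subset E) && (#|q.1| == k.+1)) &&
    ((q.2 \in q.1) && (#|(q.1 :\ q.2) :&: D| == i)).
    case: q => C x /=; rewrite xpair_eqE eqxx andbT.
    case xC: (x \in C); last first.
      rewrite /= andbF; apply/negbTE/negP => /andP[_ /eqP eC].
      by move: xC; rewrite -eC setU11.
    rewrite setD1K // eqxx andbT (cardsD1 x C) xC add1n eqSS.
    have -> : (C \subset E) = (x \in E) && (C :\ x \subset E).
      by rewrite -{1}(setD1K xC) subUset sub1set.
    rewrite !inE eqxx /=.
    by case: (x \in E); rewrite ?andbF ?andbT //= andbA.
  over.
rewrite -(pair_big_dep (fun C : {set T} => (C \subset E) && (#|C| == k.+1))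
            (fun C x => (x \in C) && (#|(C :\ x) :&: D| == i))
            (fun C x => b (x |: (C :\ x)))) /= => sum0.
rewrite -[RHS]sum0 /s -!sumrMnl [in LHS]big_mkcondr [X in _ + X = _]big_mkcondr /=.
rewrite -big_split /=; apply: eq_bigr => C /andP[_ /eqP cC].
rewrite (eq_bigr (fun=> b C)); last by move=> x /andP[xC _]; rewrite setD1K.
rewrite sumr_const.
have := card_remove_meet D i cC; rewrite cardsE => ->.
by rewrite mulrnDr; congr (_ + _); case: eqP => _; rewrite ?mul1n ?mul0n.
Qed.

(** The sums of [layer_sum_rec] vanish one after the other: layer 0 is empty, since two disjoint
    [(k + 1)]-sets do not fit into [E], and each next layer follows because [i + 1] is invertible.
    Layer [k + 1] contains only [D]. *)
Lemma inclusion_kernel_eq0 (D : {set T}) : D \subset E -> #|D| = k.+1 -> b D = 0.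
Proof.
move=> sD cD.
pose s j := \sum_(C : {set T} | (C \subset E) && (#|C| == k.+1) &&
                                 (#|C :&: D| == j)) b C.
have s0 i : (i <= k.+1)%N -> s i = 0.
  elim: i => [_|i IHi lik].
    rewrite /s big_pred0 // => C; apply/negbTE/negP => /andP[/andP[sC /eqP cC]].
    rewrite cards_eq0 => /eqP CD.
    have : (#|C :|: D| <= #|E|)%N by apply: subset_leq_card; rewrite subUset sC.
    by rewrite cardsU CD cards0 cC cD card_E; lia.
  have : s i.+1 *+ i.+1 + s i *+ (k.+1 - i) = 0 := layer_sum_rec D i.
  rewrite IHi; last by lia.
  rewrite mul0rn addr0 -mulr_natl => /eqP; rewrite mulf_eq0.
  by rewrite (negbTE (natF_neq0 _)) //= => /eqP.
rewrite -(s0 k.+1 (leqnn _)) /s (big_pred1 D) // => C /=.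
apply/idP/eqP => [/andP[/andP[_ /eqP cC] /eqP cCD]|->]; last by rewrite setIid sD cD eqxx.
have eqC : C :&: D = C by apply/eqP; rewrite eqEcard subsetIl cC cCD leqnn.
by apply/eqP; rewrite eqEcard cC cD leqnn andbT -eqC subsetIr.
Qed.
End InclusionKernel.

(** Up to sign, the sum is the coefficient of degree [#|U| - 1] in the polynomial interpolating [g]
    on [U], which is [g] itself, of smaller degree. *)
Lemma lagrange_top_coef (F : finFieldType) (U : {set F}) (g : {poly F}) :
  (size g < #|U|)%N -> \sum_(x in U) g.[x] / \prod_(u in U :\ x) (u - x) = 0.
Proof.
move=> sg.
pose q := \sum_(x in U) (g.[x] / \prod_(u in U :\ x) (u - x)) *:
            \prod_(u in U :\ x) (u%:P - 'X).
have szP x : x \in U -> (size (\prod_(u in U :\ x) (u%:P - 'X) : {poly F})%R <= #|U|)%N.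
  move=> xU; rewrite (cardsD1 x U) xU add1n.
  apply: leq_trans (size_prod_leq _ _) _.
  rewrite (eq_bigr (fun=> 2%N)) => [|u _].
    by rewrite sum_nat_const muln2 -addnn -addnS addKn.
  by rewrite -opprB size_polyN size_XsubC.
have szq : (size q <= #|U|)%N.
  apply: leq_trans (size_sum _ _ _) _; apply/bigmax_leqP => x xU.
  by apply: leq_trans (size_scale_leq _ _) _; apply: szP.
have qE x : x \in U -> q.[x] = g.[x].
  move=> xU; rewrite horner_sum (bigD1 x) //= [X in _ + X]big1 ?addr0.
    rewrite hornerZ horner_prod.
    under [X in _ * X]eq_bigr => u _ do rewrite hornerD hornerN hornerC hornerX.
    rewrite divfK //; apply/prodf_neq0 => u; rewrite !inE subr_eq0.
    by case/andP.
  move=> y /andP[yU nyx]; rewrite hornerZ horner_prod [X in _ * X](bigD1 x) /=; last first.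
    by rewrite !inE xU eq_sym nyx.
  by rewrite hornerD hornerN hornerC hornerX subrr mul0r mulr0.
have eqg : q = g.
  apply/eqP; rewrite -subr_eq0; apply/negPn/negP => nz.
  have := max_poly_roots nz (_ : all _ (enum U)) (enum_uniq _).
  rewrite -cardE.
  have rts : all (root (q - g)) (enum U).
    apply/allP => x; rewrite mem_enum => xU.
    by rewrite /root hornerD hornerN qE // subrr.
  move/(_ rts); apply/negP; rewrite -leqNgt.
  apply: leq_trans (size_polyD _ _) _.
  by rewrite size_polyN geq_max szq ltnW.
have gtop : g`_(#|U|.-1) = 0 by apply: nth_default; rewrite -ltnS (ltn_predK sg).
have ctop x : x \in U -> (\prod_(u in U :\ x) (u%:P - 'X))`_(#|U|.-1) = (-1) ^+ #|U|.-1 :> F.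
  move=> xU; have -> : #|U|.-1 = #|U :\ x| by rewrite (cardsD1 x U) xU.
  rewrite (eq_bigr (fun u => (-1)%:P * ('X - u%:P))); last first.
    by move=> u _; rewrite polyCN mulNr mul1r opprB.
  rewrite big_split /= prodr_const -polyC_exp coefCM.
  have mon : \prod_(u in U :\ x) ('X - u%:P) \is monic by apply: monic_prod_XsubC.
  have := monicP mon; rewrite lead_coefE.
  have -> : (size (\prod_(u in U :\ x) ('X - u%:P))).-1 = #|U :\ x|.
    by rewrite -big_enum /= size_prod_XsubC -cardE.
  by move=> ->; rewrite mulr1.
have := gtop; rewrite -{1}eqg coef_sum.
rewrite (eq_bigr (fun x => g.[x] / \prod_(u in U :\ x) (u - x) * (-1) ^+ #|U|.-1)).
  by rewrite -mulr_suml => /eqP; rewrite mulf_eq0 signr_eq0 orbF => /eqP.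
by move=> x xU; rewrite coefZ ctop.
Qed.

(** * MDS codes: puncturing and duality *)

Definition mds (F : fieldType) (k n : nat) (G : 'M[F]_(k, n)) : Prop :=
  forall u : 'rV_k, u != 0 -> (#|[set j | (u *m G) ord0 j == 0%R]| < k)%N.

Lemma mds_unitmx (F : fieldType) (k n : nat) (G : 'M[F]_(k, n))
    (f : 'I_k -> 'I_n) :
  mds G -> injective f -> colsub f G \in unitmx.
Proof.
move=> mG injf; rewrite unitmxE unitfE; apply/negP => /det0P[u nzu uG].
have := mG u nzu; apply/negP; rewrite -leqNgt.
rewrite -{1}(card_ord k) -(card_imset _ injf); apply: subset_leq_card.
apply/subsetP => _ /imsetP[i _ ->]; rewrite inE; apply/eqP.
by move/matrixP: uG => /(_ ord0 i); rewrite mulmx_colsub !mxE.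
Qed.

Lemma mds_colsub (F : fieldType) (k n m : nat) (G : 'M[F]_(k, n))
    (f : 'I_m -> 'I_n) : injective f -> mds G -> mds (colsub f G).
Proof.
move=> injf mG u nzu; apply: leq_trans (mG u nzu).
rewrite ltnS -(card_imset _ injf); apply: subset_leq_card.
apply/subsetP => _ /imsetP[i iZ ->].
by move: iZ; rewrite mulmx_colsub !inE mxE.
Qed.

Lemma subset_of_card (T : finType) (A : {set T}) m :
  (m <= #|A|)%N -> exists2 B : {set T}, B \subset A & #|B| = m.
Proof.
move=> le_m; exists [set x in take m (enum A)].
  by apply/subsetP => x; rewrite inE => /mem_take; rewrite mem_enum.
rewrite cardsE (card_uniqP _) ?take_uniq ?enum_uniq // size_take -cardE.
by case: ltngtP le_m.
Qed.

Lemma mds_row_free (F : fieldType) (k n : nat) (G : 'M[F]_(k, n)) :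
  (k <= n)%N -> mds G -> row_free G.
Proof.
move=> lkn mG; rewrite -kermx_eq0; apply/eqP/row_matrixP => i; rewrite row0.
apply/eqP/negPn/negP => nz; have := mG _ nz; apply/negP; rewrite -leqNgt.
rewrite -row_mul mulmx_ker row0.
rewrite (_ : [set _ | _] = setT) ?cardsT ?card_ord //.
by apply/setP => j; rewrite !inE mxE eqxx.
Qed.

(** A word of the dual code with [n - k] zeros is supported on [k] positions. There it is orthogonal
    to the rows of a square submatrix of [G], invertible by [mds_unitmx], so it is zero. *)
Lemma mds_dual (F : fieldType) (k n : nat) (G : 'M[F]_(k, n)) :
  (k <= n)%N -> mds G -> exists H : 'M[F]_(n - k, n), mds H.
Proof.
move=> lkn mG.
have rG : \rank (kermx G^T) = (n - k)%N.
  rewrite mxrank_ker mxrank_tr; congr (_ - _)%N; apply/eqP.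
  exact: mds_row_free.
have : exists H : 'M[F]_(\rank (kermx G^T), n), row_free H /\ H *m G^T = 0.
  exists (row_base (kermx G^T)); split; first exact: row_base_free.
  by apply/sub_kermxP; rewrite eq_row_base.
rewrite rG => -[H [fH HG]]; exists H => u nzu.
set w := u *m H; rewrite ltnNge; apply/negP => leZ.
have nzw : w != 0.
  by apply: contra nzu => /eqP w0; rewrite -(mulmx_free_eq0 _ fH) -/w w0.
have wG : w *m G^T = 0 by rewrite -mulmxA HG mulmx0.
move: w leZ nzw wG => w leZ nzw wG.
have [Z sZ cZ] := subset_of_card leZ.
have cB : #|~: Z| = k by have := cardsC Z; rewrite card_ord; lia.
pose f (i : 'I_k) := enum_val (cast_ord (esym cB) i).
have injf : injective f by move=> i j /enum_val_inj/cast_ord_inj.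
have fB i : f i \in ~: Z by apply: enum_valP.
have fE : [set f i | i : 'I_k] = ~: Z.
  apply/eqP; rewrite eqEcard card_imset // card_ord cB leqnn andbT.
  by apply/subsetP => _ /imsetP[i _ ->].
have w0 i j : j \in Z -> w i j = 0.
  by rewrite (ord1 i); move/(subsetP sZ); rewrite inE => /eqP.
have wf : colsub f w *m (colsub f G)^T = 0.
  rewrite -wG; apply/matrixP => i l; rewrite !mxE.
  rewrite [RHS](bigID (mem Z)) /= [X in _ = X + _]big1 ?add0r => [|j jZ]; last by rewrite w0 ?mul0r.
  rewrite [RHS](eq_bigl (mem (f @: 'I_k))) => [|j]; last by rewrite fE !inE.
  by rewrite big_imset /=; [apply: eq_bigr => j _; rewrite !mxE | exact: in2W].
move: nzw => /negP; apply.
have : colsub f w = 0.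
  rewrite -(mulmxK (_ : (colsub f G)^T \in unitmx) (colsub f w)) ?wf ?mul0mx //.
  by rewrite unitmx_tr mds_unitmx.
move/matrixP => wf0; apply/eqP/matrixP => i j; rewrite [RHS]mxE.
case jZ: (j \in Z); first exact: w0.
have : j \in f @: 'I_k by rewrite fE inE jZ.
by case/imsetP => a _ ->; have := wf0 i a; rewrite !mxE.
Qed.

(** * Brackets: maximal minors of a generator matrix *)

Lemma det_mx2 (R : comNzRingType) (M : 'M[R]_2) :
  \det M = M ord0 ord0 * M ord_max ord_max - M ord_max ord0 * M ord0 ord_max.
Proof.
rewrite (expand_det_col _ ord0) !big_ord_recl big_ord0 /cofactor !det_mx11 !mxE /=.
rewrite expr0 expr1 addr0 mul1r mulN1r mulrN.
by congr (_ * M _ _ - M _ _ * M _ _); apply: val_inj.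
Qed.

Section Brackets.
Variables (F : fieldType) (k n : nat) (G : 'M[F]_(k.+2, n)).

(** The maximal minor on the columns [v, s]. When [size s = k + 1], the default value of [nth] is
    never reached. *)
Definition bracket (s : seq 'I_n) (v : 'I_n) : F :=
  \det (\matrix_(i < k.+2, j < k.+2) G i (nth v (v :: s) j)).

(** The first column stays in place, so the sign [e] is the same for all [v]. *)
Lemma bracket_perm s1 s2 : size s1 = k.+1 -> perm_eq s1 s2 ->
  exists2 e : F, e ^+ 2 = 1 & forall v, bracket s1 v = e * bracket s2 v.
Proof.
move=> sz1 eq12; have sz2 : size s2 == k.+1 by rewrite -(perm_size eq12) sz1.
have /tuple_permP[/= q def_s1] : perm_eq s1 (Tuple sz2) by [].
exists ((-1) ^+ q) => [|v]; first by rewrite sqrr_sign.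
pose M2 := \matrix_(i < k.+2, j < k.+2) G i (nth v (v :: s2) j).
rewrite /bracket -/M2.
suff -> : (\matrix_(i < k.+2, j < k.+2) G i (nth v (v :: s1) j)) =
          col_perm (lift0_perm q) M2.
  rewrite col_permE det_mulmx det_perm mulrC odd_permV.
  by rewrite /lift0_perm odd_lift_perm.
apply/matrixP => i j; rewrite !mxE; congr (G i _).
case: (unliftP ord0 j) => [j' ->|->]; last by rewrite lift0_perm0.
rewrite lift0_perm_lift /= add0n def_s1 (nth_map j') ?size_enum_ord ?ltn_ord //.
by rewrite (tnth_nth v) nth_ord_enum.
Qed.

Lemma bracket_neq0 s v :
  mds G -> size s = k.+1 -> uniq (v :: s) -> bracket s v != 0.
Proof.
move=> mG sz us; rewrite /bracket.
have injf : injective (fun j : 'I_k.+2 => nth v (v :: s) j).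
  move=> i j /eqP; rewrite nth_uniq //= ?sz // => /eqP eij; exact: val_inj.
have := mds_unitmx mG injf; rewrite unitmxE unitfE.
by congr (\det _ != 0); apply/matrixP => i j; rewrite !mxE.
Qed.

(** Modulo the span of the columns in [A], all columns lie in a plane, where the bracket is a 2 x 2
    determinant up to the constant [c]. The coordinates [r0], [r1] make [z] the first basis
    vector. *)
Lemma bracket_plane A z :
  mds G -> size A = k -> uniq (z :: A) -> (k.+2 <= n)%N ->
  exists r0 r1 : 'I_n -> F, exists2 c, c != 0 &
    [/\ r0 z = 1, r1 z = 0
      & forall s x, bracket (x :: A) s = c * (r0 s * r1 x - r1 s * r0 x)].
Proof.
move=> mG szA uzA le_n.
have [z' z'A] : exists z', z' \notin z :: A.
  apply/existsP; rewrite -negb_forall; apply: contraL le_n => /forallP allA.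
  rewrite -ltnNge ltnS -(card_ord n) -szA -[_.+1]/(size (z :: A)).
  rewrite -(card_uniqP uzA); apply: subset_leq_card; apply/subsetP => x _.
  by have := allA x.
have injf : injective (fun j : 'I_k.+2 => nth z (z :: z' :: A) j).
  move=> i j /eqP; rewrite nth_uniq /= ?szA //; first by move/eqP/val_inj.
  by move: z'A uzA; rewrite !inE /= !negb_or (eq_sym z) => /andP[-> ->] /andP[-> ->].
set f := fun j => _ in injf; pose M := colsub f G; pose G' := invmx M *m G.
have uM : M \in unitmx by apply: mds_unitmx.
have G'f i j : G' i (f j) = (i == j)%:R.
  have : colsub f G' = 1%:M by rewrite -mulmx_colsub mulVmx.
  by move/matrixP => /(_ i j); rewrite !mxE.
pose i0 : 'I_k.+2 := ord0; pose i1 : 'I_k.+2 := lift ord0 ord0.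
exists (G' i0), (G' i1), (\det M); first by rewrite -unitfE -unitmxE.
split; [exact: (G'f i0 i0) | exact: (G'f i1 i0) | move=> s x].
pose N : 'M_(2 + k) := \matrix_(i < k.+2, j < k.+2) G' i (nth s (s :: x :: A) j).
have -> : bracket (x :: A) s = \det M * \det N.
  rewrite -det_mulmx; congr (\det _); apply/matrixP => i j; rewrite !mxE.
  have -> : G = M *m G' by rewrite mulmxA mulmxV ?mul1mx.
  by rewrite mxE; apply: eq_bigr => l _; rewrite !mxE.
congr (_ * _).
(* In the basis [z, z', A] the columns in [A] are unit vectors, so [N] is block lower triangular
   with an identity block. *)
have NA (i : 'I_(2 + k)) (j : 'I_k) : N i (rshift 2 j) = (i == rshift 2 j)%:R.
  rewrite mxE -G'f; congr (G' i _); rewrite /f /= add0n.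
  by apply: set_nth_default; rewrite szA.
rewrite -[N]submxK.
have -> : ursubmx N = 0.
  by apply/matrixP => i j; rewrite [LHS]mxE [LHS]mxE NA eq_lrshift mxE.
have -> : drsubmx N = 1%:M.
  by apply/matrixP => i j; rewrite [LHS]mxE [LHS]mxE NA eq_rshift mxE.
have -> : i0 = lshift k (ord0 : 'I_2) by apply: val_inj.
have -> : i1 = lshift k (ord_max : 'I_2) by apply: val_inj.
by rewrite det_lblock det1 mulr1 det_mx2 !mxE.
Qed.

End Brackets.

(** * Ball's theorem in length [p + 2] *)

Lemma prod_diff_compl (F : finFieldType) (V : {set F}) :
  exists2 W : F, W != 0 & forall x, x \in V ->
    (\prod_(v in V :\ x) (v - x)) * (\prod_(c in ~: V) (c - x)) = W.
Proof.
(* Whatever [x] is, the differences [c - x] with [c != x] run over all nonzero field elements. *)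
exists (\prod_(c : F | c != 0) c); first by apply/prodf_neq0 => c.
move=> x xV; rewrite [RHS](reindex_inj (addIr (- x))) /=.
rewrite [RHS](bigID (mem V)) /=; congr (_ * _); apply: eq_bigl => c.
  by rewrite !inE subr_eq0.
rewrite !inE subr_eq0; case: (eqVneq c x) => // ->; by rewrite xV.
Qed.

Lemma expf_card_pred (F : finFieldType) (x : F) : x != 0 -> x ^+ #|F|.-1 = 1.
Proof.
move=> nzx; apply: (mulIf nzx); rewrite mul1r -exprSr prednK ?expf_card //.
by apply/card_gt0P; exists x.
Qed.

(** Exponent count for [beta_sum]: the factor [c * r1 x] occurs once for [z], [p - k] times in the
    product over [T] and [k] times in that over [U]; Fermat reduces the power of [r1 x] to 2. *)
Lemma collect_powers (F : fieldType) (p k : nat) (c r : F) :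
  (0 < p)%N -> (k <= p)%N -> r ^+ p.-1 = 1 ->
  c * r * (c * r) ^+ (p.+1 - k).-1 * (c * r) ^+ k = c ^+ p.+1 * r ^+ 2.
Proof.
move=> p_gt0 le_kp r1.
have e1 : ((p.+1 - k).-1.+1 + k = p.+1)%N by lia.
have e2 : (p.-1 + 2 = p.+1)%N by lia.
have rE : r ^+ p.+1 = r ^+ 2 by rewrite -e2 exprD r1 mul1r.
by rewrite -exprS -exprD e1 exprMn rE.
Qed.

(** The [r ^+ 2] left by [collect_powers] cancels against the two quotients by [r]. *)
Lemma collect_factors (F : fieldType) (y m1 m2 r c s1 s2 q1 q2 : F) :
  r != 0 -> y * m1 * m2 = c * r ^+ 2 ->
  y * (m1 * (s1 / r) * q1) * (m2 * (s2 / r) * q2) = c * s1 * s2 * q1 * q2.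
Proof.
move=> nzr e.
have -> : y * (m1 * (s1 / r) * q1) * (m2 * (s2 / r) * q2) =
  (y * m1 * m2) * (s1 / r) * (s2 / r) * q1 * q2 by ring.
by rewrite e; field.
Qed.

Section Ball.
(* The dimension of the code is [k + 2]. *)
Variables (F : finFieldType) (p k n : nat) (G : 'M[F]_(k.+2, n)) (E : {set 'I_n}).
Hypotheses (cardF : #|F| = p) (charF : p \in [pchar F]) (p_odd : odd p).
Hypotheses (nE : n = p.+2) (mG : mds G).
Hypotheses (k_gt0 : (0 < k)%N) (le_kp : (k.*2.+3 <= p)%N) (cE : #|E| = k.*2.+1).

(** For [C] in [E], the second product makes the number of brackets even, and it supplies the
    denominators of [lagrange_top_coef]. *)
Let beta (C : {set 'I_n}) : F :=
  (\prod_(s in ~: C) bracket G (enum C) s *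
   \prod_(u in E :\: C) bracket G (enum C) u)^-1.

Lemma beta_neq0 (C : {set _}) : #|C| = k.+1 -> beta C != 0.
Proof.
move=> cC; have nz s : s \notin C -> bracket G (enum C) s != 0.
  by move=> sC; apply: bracket_neq0; rewrite //= -?cardE ?mem_enum ?sC ?enum_uniq.
rewrite invr_eq0 mulf_eq0 negb_or; apply/andP; split; apply/prodf_neq0 => s.
  by rewrite inE; apply: nz.
by rewrite inE => /andP[sC _]; apply: nz.
Qed.

(* The bracket occurs p + 1 times in beta, hence its sign is irrelevant. *)
Lemma beta_order (A : {set _}) x : #|A| = k -> x \in E -> x \notin A -> A \subset E ->
  beta (x |: A) =
  (\prod_(s in ~: (x |: A)) bracket G (x :: enum A) s *
   \prod_(u in E :\: (x |: A)) bracket G (x :: enum A) u)^-1.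
Proof.
move=> cA xE xA sA; set C := x |: A.
have cC : #|C| = k.+1 by rewrite cardsU1 xA cA.
have [||e e2 eE] := @bracket_perm _ _ _ G (enum C) (x :: enum A).
- by rewrite -cardE cC.
- apply: uniq_perm; rewrite /= ?enum_uniq ?mem_enum ?xA // => y.
  by rewrite inE !mem_enum !inE.
rewrite /beta; congr _^-1.
under eq_bigr => s _ do rewrite eE.
under [X in _ * X]eq_bigr => s _ do rewrite eE.
rewrite !big_split /= !prodr_const mulrACA -exprD.
have sCE : C \subset E by rewrite subUset sub1set xE sA.
have c1 : #|~: C| = (p.+1 - k)%N.
  by have := cardsC C; rewrite card_ord cC; lia.
have c2 : #|E :\: C| = k by rewrite cardsD (setIidPr sCE) cE cC; lia.
rewrite c1 c2 subnK; last by lia.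
have -> : p.+1 = (2 * p.+1./2)%N by move: p_odd; lia.
by rewrite exprM e2 expr1n mul1r.
Qed.

(** In an affine coordinate [a] on the projective line of the plane modulo [A], every factor that
    depends on [x] cancels, except differences of values of [a]. What remains is a Lagrange sum on
    [k + 1] points for a polynomial of degree [k - 1]. *)
Lemma beta_sum (A : {set 'I_n}) : A \subset E -> #|A| = k ->
  \sum_(x in E :\: A) beta (x |: A) = 0.
Proof.
move=> sA cA.
have lekp' : (k <= p)%N by move: le_kp; clear; lia.
have p_gt0 : (0 < p)%N by move: le_kp; clear; lia.
(* [z] becomes the point at infinity of [a]; taking it outside [E] keeps all points of [E :\: A]
   affine. *)
have [z zE] : exists z, z \notin E.
  apply/existsP; rewrite -negb_forall; apply/negP => /forallP allE.
  have : (#|'I_n| <= #|E|)%N by apply/subset_leq_card/subsetP => x _; apply: allE.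
  by rewrite card_ord cE; lia.
have zA : z \notin A by apply: contra zE; apply: (subsetP sA).
have [||||r0 [r1 [c nzc [r0z r1z plane]]]] := @bracket_plane _ _ _ G (enum A) z => //.
- by rewrite -cardE.
- by rewrite /= mem_enum zA enum_uniq.
- by lia.
pose T := ~: (z |: A); pose U := E :\: A.
have zT : z \notin T by rewrite !inE eqxx.
have sUT : U \subset T.
  apply/subsetP => x; rewrite !inE negb_or => /andP[-> xE]; rewrite andbT.
  by apply: contra zE => /eqP <-.
have cT : #|T| = (p.+1 - k)%N.
  by have := cardsC (z |: A); rewrite -/T card_ord cardsU1 zA cA; lia.
have cU : #|U| = k.+1 by rewrite cardsD (setIidPr sA) cE cA; lia.
have zbr x : bracket G (x :: enum A) z = c * r1 x.
  by rewrite plane r0z r1z mul1r mul0r subr0.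
have nzr x : x \in T -> r1 x != 0.
  rewrite !inE negb_or => /andP[xz xA].
  have : bracket G (x :: enum A) z != 0.
    apply: bracket_neq0 => //=; first by rewrite -cardE cA.
    by rewrite !inE negb_or eq_sym xz !mem_enum zA xA enum_uniq.
  by rewrite zbr mulf_eq0 negb_or => /andP[].
pose a x := r0 x / r1 x.
have brE s x : s \in T -> x \in T ->
    bracket G (x :: enum A) s = (c * r1 x) * r1 s * (a s - a x).
  move=> sT xT; rewrite plane /a; field.
  by rewrite !nzr.
have inja : {in T &, injective a}.
  move=> s x sT xT eqa; apply/eqP; apply: contraT => nsx.
  have : bracket G (x :: enum A) s != 0.
    move: sT xT; rewrite !inE !negb_or => /andP[_ sA'] /andP[_ xA'].
    apply: bracket_neq0 => //=; first by rewrite -cardE cA.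
    by rewrite !inE negb_or nsx !mem_enum sA' xA' enum_uniq.
  by rewrite brE // eqa subrr mulr0 eqxx.
have prodE (V : {set 'I_n}) x : V \subset T -> x \in V ->
    \prod_(s in V :\ x) bracket G (x :: enum A) s =
    (c * r1 x) ^+ (#|V|.-1) * (\prod_(s in V) r1 s / r1 x) *
    \prod_(y in (a @: V) :\ a x) (y - a x).
  move=> sV xV; have xT := subsetP sV x xV.
  have -> : (a @: V) :\ a x = a @: (V :\ x).
    apply/setP => y; rewrite !inE; apply/andP/imsetP.
      move=> [nyx /imsetP[v vV eyv]]; exists v => //; rewrite !inE vV andbT.
      by apply: contraNneq nyx => <-; rewrite eyv.
    move=> [v]; rewrite !inE => /andP[nvx vV] ->.
    split; last exact: imset_f.
    apply: contraNneq nvx => eva; apply/eqP/inja => //.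
    exact: subsetP vV.
  rewrite big_imset /=; last first.
    move=> u v; rewrite !inE => /andP[_ uV] /andP[_ vV].
    by apply: inja; apply: (subsetP sV).
  rewrite (eq_bigr (fun s => (c * r1 x) * r1 s * (a s - a x))); last first.
    by move=> s; rewrite !inE => /andP[_ sV']; rewrite brE // (subsetP sV).
  rewrite 2!big_split /= prodr_const; congr (_ ^+ _ * _ * _).
    by rewrite (cardsD1 x V) xV.
  rewrite [in RHS](big_setD1 x) //= mulrAC mulfV ?mul1r //.
  exact: nzr.
have [W nzW WE] := prod_diff_compl (a @: T).
(* The roots of [g] are the field elements that are not values of [a] on [T]. By [WE], [g.[a x]]
   replaces the inverse of the product over [T], up to [W]. *)
pose g : {poly F} := \prod_(y in ~: (a @: T)) (y%:P - 'X).
pose RT := \prod_(s in T) r1 s; pose RU := \prod_(s in U) r1 s.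
have betaE x : x \in U -> beta (x |: A) =
    (c ^+ p.+1 * RT * RU * W)^-1 *
    (g.[a x] / \prod_(y in (a @: U) :\ a x) (y - a x)).
  move=> xU; have xT := subsetP sUT x xU.
  have [xE xA] : x \in E /\ x \notin A by move: xU; rewrite inE => /andP[].
  rewrite beta_order //.
  have -> : ~: (x |: A) = z |: (T :\ x).
    apply/setP => y; rewrite !inE !negb_or; case: (eqVneq y z) => [->|] //=.
    by rewrite zA andbT; apply: contraNneq zE => ->.
  have -> : E :\: (x |: A) = U :\ x.
    by apply/setP => y; rewrite !inE negb_or andbA.
  rewrite big_setU1 /=; last by rewrite !inE eqxx andbF.
  rewrite zbr prodE // prodE // -/RT -/RU cT cU /=.
  have := WE (a x) (imset_f a xT).
  have gE : \prod_(y in ~: (a @: T)) (y - a x) = g.[a x].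
    by rewrite horner_prod; apply: eq_bigr => y _; rewrite hornerD hornerN hornerC hornerX.
  rewrite gE.
  set PT := \prod_(y in _ :\ _) _; set PU := \prod_(y in _ :\ _) _ => WE'.
  have nzrx := nzr x xT.
  have fermat : r1 x ^+ p.-1 = 1 by rewrite -cardF expf_card_pred.
  have nzPT : PT != 0 by apply: contra nzW => /eqP PT0; rewrite -WE' PT0 mul0r.
  have nzg : g.[a x] != 0 by apply: contra nzW => /eqP g0; rewrite -WE' g0 mulr0.
  have crE := collect_powers c p_gt0 lekp' fermat.
  by rewrite (collect_factors _ _ _ _ nzrx crE) -WE' !invfM !mulrA divfK.
under eq_bigr => x xU do rewrite betaE //.
have injU : {in U &, injective a}.
  by move=> u v uU vU; apply: inja; apply: (subsetP sUT).
rewrite -mulr_sumr.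
rewrite -(big_imset (fun y => g.[y] / \prod_(v in (a @: U) :\ y) (v - y))) //=.
rewrite lagrange_top_coef ?mulr0 //.
(* [g] has degree [p - #|T| = k - 1], hence size at most [k < #|U|]. *)
rewrite card_in_imset // cU ltnS.
apply: leq_trans (size_prod_leq _ _) _.
rewrite (eq_bigr (fun=> 2%N)) => [|u _]; last by rewrite -opprB size_polyN size_XsubC.
rewrite sum_nat_const muln2 -addnn -addnS addKn.
have := cardsC (a @: T); rewrite card_in_imset // cardF cT.
by move=> cTc; rewrite -(ltn_add2l (p.+1 - k)) cTc subnK ?ltnS // ltnW.
Qed.

Lemma no_mds_of_length_p2 : False.
Proof.
have [D sD cD] : exists2 D : {set 'I_n}, D \subset E & #|D| = k.+1.
  by apply: subset_of_card; rewrite cE; lia.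
have := beta_neq0 cD; rewrite (@inclusion_kernel_eq0 _ _ E k beta) ?eqxx //.
  move=> i /andP[i_gt0 lik]; rewrite -(dvdn_pcharf charF).
  by rewrite gtnNdvd //; lia.
exact: beta_sum.
Qed.
End Ball.

(** * Hamming weights and the Plotkin bound *)

Definition hamming_weight (F : fieldType) (n : nat) (v : 'rV[F]_n) : nat :=
  #|[set j | v ord0 j != 0%R]|.

Lemma card_zeros (F : fieldType) (n : nat) (v : 'rV[F]_n) :
  (#|[set j | v ord0 j == 0%R]| + hamming_weight v = n)%N.
Proof.
rewrite -[RHS]card_ord -(cardsC [set j | v ord0 j == 0]); congr (_ + _)%N.
by apply: eq_card => j; rewrite !inE.
Qed.

Lemma systematic_form (F : fieldType) (k n : nat) (G : 'M[F]_(k, n)) :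
  row_free G -> exists (B : 'M[F]_k) (f : 'I_k -> 'I_n),
    injective f /\ colsub f (B *m G) = 1%:M.
Proof.
move=> rG; have fG : row_full G^T by rewrite /row_full mxrank_tr.
exists (invmx (colsub (fullrankfun fG) G)), (fullrankfun fG).
split; first exact: fullrankfun_inj.
rewrite -mulmx_colsub mulVmx // -unitmx_tr trmx_mxsub.
exact: fullrowsub_unit.
Qed.

(** Take one word for each of the [#|F| + 1] points of a projective line of words vanishing on the
    [k]-set [Z]. At every other position at least one of them vanishes, so their weights add up to
    at most [(n - k) * #|F|]. *)
Lemma two_dim_plotkin (F : finFieldType) (k n w : nat) (G : 'M[F]_(k.+2, n)) :
  row_free G -> (forall u, u != 0 -> (w <= hamming_weight (u *m G))%N) ->
  (w * #|F|.+1 <= (n - k) * #|F|)%N.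
Proof.
move=> fG le_w; have [B [f [injf sysG]]] := systematic_form fG.
have sysE i j : (B *m G) i (f j) = (i == j)%:R.
  by move/matrixP: sysG => /(_ i j); rewrite !mxE.
pose i0 : 'I_k.+2 := ord0; pose i1 : 'I_k.+2 := lift ord0 ord0.
(* [option F] parametrizes the projective line spanned by the first two systematic rows; [None] is
   the point at infinity. *)
pose x (o : option F) : 'rV[F]_k.+2 :=
  if o is Some a then delta_mx ord0 i0 + a *: delta_mx ord0 i1 else delta_mx ord0 i1.
pose g o j := (x o *m B *m G) ord0 j.
have gE o j : g o j = if o is Some a then (B *m G) i0 j + a * (B *m G) i1 j
                      else (B *m G) i1 j.
  by rewrite /g /x -mulmxA; case: o => [a|]; rewrite ?mulmxDl -?scalemxAl -?rowE !mxE.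
have nzx o : x o *m B != 0.
  apply/eqP => x0; have : g o (f i0) = 0 /\ g o (f i1) = 0 by rewrite /g x0 mul0mx !mxE.
  by rewrite !gE !sysE; case: o {x0} => [a|] [] /eqP;
    rewrite ?mulr0 ?addr0 ?oner_eq0 // => _ /eqP; rewrite oner_eq0.
pose Z := f @: [set i | (i != i0) && (i != i1)].
have cZ : #|Z| = k.
  rewrite card_imset //.
  have := cardsC [set i0; i1]; rewrite cards2 card_ord /= => e.
  have -> : [set i | (i != i0) && (i != i1)] = ~: [set i0; i1].
    by apply/setP => i; rewrite !inE negb_or.
  by move: e; clear; lia.
have gZ o j : j \in Z -> g o j = 0.
  case/imsetP => i; rewrite inE ![i == _]eq_sym => /andP[/negbTE n0 /negbTE n1] ->.
  by rewrite gE !sysE n0 n1; case: o => // a; rewrite mulr0 addr0.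
have sum_le : (\sum_(o : option F) hamming_weight (x o *m B *m G) <= (n - k) * #|F|)%N.
  rewrite (eq_bigr (fun o => \sum_(j < n) (g o j != 0%R)))%N; last first.
    by move=> o _; rewrite /hamming_weight cardsE -sum1_card big_mkcond.
  rewrite exchange_big /=.
  apply: (@leq_trans (\sum_(j < n) (j \notin Z) * #|F|)%N); last first.
    rewrite -big_distrl /= leq_mul2r; apply/orP; right.
    rewrite -big_mkcond sum1_card.
    have := cardsC Z; rewrite cZ card_ord => e.
    have -> : #|[pred j | j \notin Z]| = #|~: Z| by apply: eq_card => j; rewrite !inE.
    by move: e; clear; lia.
  apply: leq_sum => j _; case jZ: (j \in Z) => /=.
    by rewrite big1 // => o _; rewrite gZ ?eqxx.
  rewrite mul1n.
  have [o go] : exists o, g o j = 0.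
    case: (eqVneq ((B *m G) i1 j) 0) => [e|nz]; first by exists None; rewrite gE.
    exists (Some (- (B *m G) i0 j / (B *m G) i1 j)).
    by rewrite gE divfK // subrr.
  rewrite (bigD1 o) //= go eqxx add0n.
  apply: (@leq_trans (\sum_(i | i != o) 1)%N); first by apply: leq_sum => i _; case: (_ != _).
  by rewrite sum1_card; have := cardC1 o; rewrite card_option /= => <-.
apply: leq_trans sum_le.
rewrite mulnC -card_option -sum_nat_const.
by apply: leq_sum => o _; apply: le_w.
Qed.

Lemma mds_weight (F : fieldType) (k n : nat) (G : 'M[F]_(k, n)) u :
  (k <= n)%N -> mds G -> u != 0 -> (n - k < hamming_weight (u *m G))%N.
Proof.
move=> lkn mG nzu; rewrite ltn_subLR // -[X in (X < _)%N](card_zeros (u *m G)).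
by rewrite ltn_add2r; apply: mG.
Qed.

(** With [w = n - 1] and [q = #|F|], [two_dim_plotkin] reads [(n - 1) (q + 1) <= n q]. *)
Lemma mds2_length (F : finFieldType) (n : nat) (G : 'M[F]_(2, n)) :
  (2 <= n)%N -> mds G -> (n <= #|F|.+1)%N.
Proof.
move=> n_ge2 mG.
have := two_dim_plotkin (mds_row_free n_ge2 mG) (fun u => @mds_weight _ _ _ _ u n_ge2 mG).
by rewrite subn0; move: n_ge2; clear; nia.
Qed.

Lemma mds_puncture (F : fieldType) (k n m : nat) (G : 'M[F]_(k, n)) :
  (m <= n)%N -> mds G -> exists H : 'M[F]_(k, m), mds H.
Proof.
move=> le_mn mG; exists (colsub (widen_ord le_mn) G); apply: mds_colsub mG.
by move=> i j /(congr1 val) /= /val_inj.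
Qed.

(** * Lengths of MDS codes over the prime field *)

Section PrimeField.
Variables (F : finFieldType) (p : nat).
Hypotheses (p_pr : prime p) (cardF : #|F| = p) (charF : p \in [pchar F]).

(** Dimension 2 is [mds2_length]. From dimension 3 on, [p] is odd, which sharpens [2 k <= p + 2] to
    the [2 k <= p + 1] required in the section [Ball]. *)
Lemma mds_low_dim (k : nat) (G : 'M[F]_(k, p.+2)) :
  (2 <= k)%N -> (k.*2 <= p.+2)%N -> ~ mds G.
Proof.
case: k G => [|[|[|k]]] // G _ le_k mG.
  by have := mds2_length (isT : 2 <= p.+2)%N mG; rewrite cardF ltnn.
have p_odd : odd p by case: (even_prime p_pr) => // p2; move: le_k; rewrite p2.
have [E _ cE] : exists2 E : {set 'I_p.+2}, E \subset setT & #|E| = k.+1.*2.+1.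
  by apply: subset_of_card; rewrite cardsT card_ord; lia.
apply: (@no_mds_of_length_p2 F p k.+1 p.+2 G E) => //.
by move: le_k p_odd; clear; lia.
Qed.

(** If [k > p], puncturing to length [k + 2] and dualizing gives dimension 2, too long for
    [mds2_length]. If [k <= p], puncture to length [p + 2]: the code or its dual has dimension
    between 2 and [(p + 2) / 2], against [mds_low_dim]. *)
Lemma mds_prime_length (k n : nat) (G : 'M[F]_(k, n)) :
  (2 <= k)%N -> (k.+2 <= n)%N -> mds G -> (n <= p.+1)%N.
Proof.
move=> k_ge2 k_le mG; rewrite leqNgt; apply/negP => n_gt.
have [le_kp|lt_pk] := leqP k p; last first.
  have [H1 mH1] := mds_puncture k_le mG.
  have [H2] : exists H : 'M[F]_(k.+2 - k, k.+2), mds H by apply: mds_dual mH1; lia.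
  have e : (k.+2 - k = 2)%N by lia.
  move: H2; rewrite e => H2 mH2.
  by have := mds2_length (isT : 2 <= k.+2)%N mH2; rewrite cardF; lia.
have [H mH] := mds_puncture n_gt mG.
have [le2k|lt2k] := leqP k.*2 p.+2; first exact: (mds_low_dim k_ge2 le2k mH).
have [|H' mH'] := mds_dual _ mH; first by lia.
by apply: mds_low_dim mH'; lia.
Qed.
End PrimeField.

(** * Averages of Lee weights over the prime field *)

Definition Fp_lee (p : nat) (a : 'F_p) : nat := minn a (p - a).

Definition Fp_lee_vec (p n : nat) (v : 'rV['F_p]_n) : nat :=
  (\sum_(j < n) Fp_lee (v ord0 j))%N.

Definition Fp_lee_sum (p : nat) : nat := (\sum_(a : 'F_p) Fp_lee a)%N.

Lemma Fp_lee0 (p : nat) : Fp_lee (0 : 'F_p) = 0%N.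
Proof. by rewrite /Fp_lee min0n. Qed.

Lemma Fp_lee1 (p : nat) : prime p -> Fp_lee (1 : 'F_p) = 1%N.
Proof.
move=> p_pr; have p_gt1 := prime_gt1 p_pr.
by rewrite /Fp_lee /= modn_small //; lia.
Qed.

Lemma Fp_lee_sum_affine (p : nat) (b c : 'F_p) : c != 0 ->
  (\sum_(a : 'F_p) Fp_lee (b + a * c)%R = Fp_lee_sum p)%N.
Proof.
move=> nzc; rewrite /Fp_lee_sum [RHS](reindex (fun a => b + a * c)) //.
exists (fun x => (x - b) / c) => a _; first by rewrite addrAC subrr add0r mulfK.
by rewrite divfK // addrC subrK.
Qed.

Lemma mu_Fp_lee_sum (p : nat) : prime p ->
  mu p = (Fp_lee_sum p)%:R / (p - 1)%N%:R.
Proof.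
move=> p_pr; have p_gt1 := prime_gt1 p_pr; rewrite /mu; congr (_%:R / _).
pose s m := (\sum_(0 <= i < m) minn i (p - i))%N.
have -> : Fp_lee_sum p = s p.
  by rewrite -[X in s X](Fp_cast p_pr) /s big_mkord.
transitivity (s (Zp_trunc p).+2); last by rewrite Zp_cast.
by rewrite /s big_mkord [RHS](bigD1 ord0) //= min0n add0n.
Qed.

Section LeeAverages.
Variables (p k n d : nat) (G : 'M['F_p]_(k, n)).
Hypothesis p_pr : prime p.
Hypothesis le_d : forall u, u != 0 -> (d <= Fp_lee_vec (u *m G))%N.

(** Sum over the [p - 1] nonzero multiples of [u]: each nonzero coordinate of the word runs over all
    nonzero residues. *)
Lemma lee_le_hamming u : u != 0 ->
  (d * (p - 1) <= hamming_weight (u *m G) * Fp_lee_sum p)%N.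
Proof.
move=> nzu; apply: (@leq_trans (\sum_(a : 'F_p | a != 0%R) Fp_lee_vec ((a *: u) *m G)%R)%N).
  have -> : (d * (p - 1) = \sum_(a : 'F_p | a != 0%R) d)%N.
    rewrite sum_nat_const mulnC subn1 -{1}(card_Fp p_pr).
    by rewrite -(cardC1 (0 : 'F_p)); congr (_ * _)%N; apply: eq_card => a; rewrite !inE.
  by apply: leq_sum => a nza; apply: le_d; rewrite scaler_eq0 negb_or nza.
rewrite /Fp_lee_vec exchange_big /= /hamming_weight -sum1_card big_distrl /=.
rewrite [X in (_ <= X)%N]big_mkcond /=; apply: leq_sum => j _.
set c := (u *m G) ord0 j; rewrite inE -/c.
rewrite (eq_bigr (fun a => Fp_lee (0 + a * c))); last first.
  by move=> a _; rewrite -scalemxAl mxE add0r.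
case: (eqVneq c 0) => [->|nzc] /=.
  by rewrite big1 // => a _; rewrite mulr0 addr0 Fp_lee0.
rewrite mul1n -(Fp_lee_sum_affine 0 nzc) [X in (_ <= X)%N](bigD1 0) //=.
by rewrite leq_addl.
Qed.
End LeeAverages.

(** Sum over the [p] words [w0 + a w1], with [w0], [w1] the first two systematic rows. The position
    [f i0] contributes 1 to each word, the rest of [Z] nothing, and each of the [n - k - 1]
    positions outside [Z] contributes [Fp_lee_sum p] in total, because [w1] is nonzero there. *)
Lemma mds_lee_le (p k n d : nat) (G : 'M['F_p]_(k.+2, n)) : prime p ->
  (k.+2 <= n)%N -> mds G -> (forall u, u != 0 -> (d <= Fp_lee_vec (u *m G))%N) ->
  (d * p <= p + (n - k.+1) * Fp_lee_sum p)%N.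
Proof.
move=> p_pr le_kn mG le_d.
have [B [f [injf sysG]]] := systematic_form (mds_row_free le_kn mG).
have sysE i j : (B *m G) i (f j) = (i == j)%:R.
  by move/matrixP: sysG => /(_ i j); rewrite !mxE.
pose i0 : 'I_k.+2 := ord0; pose i1 : 'I_k.+2 := lift ord0 ord0.
pose x (a : 'F_p) : 'rV['F_p]_k.+2 := delta_mx ord0 i0 + a *: delta_mx ord0 i1.
pose g a j := (x a *m B *m G) ord0 j.
have gE a j : g a j = (B *m G) i0 j + a * (B *m G) i1 j.
  by rewrite /g /x -mulmxA ?mulmxDl -?scalemxAl -?rowE !mxE.
have nzx a : x a *m B != 0.
  apply/eqP => x0; have : g a (f i0) = 0 by rewrite /g x0 mul0mx !mxE.
  by rewrite gE !sysE mulr0 addr0 => /eqP; rewrite oner_eq0.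
pose Z := f @: [set~ i1].
have cZ : #|Z| = k.+1 by rewrite card_imset // cardsC1 card_ord.
(* Row [i1] already vanishes at the [k + 1] positions of [Z], the most that [mds] permits in
   dimension [k + 2]. *)
have nzBG j : j \notin Z -> (B *m G) i1 j != 0.
  move=> jZ; apply/eqP => e.
  have nzr : row i1 B != 0.
    apply/eqP => r0; have := sysE i1 i1; rewrite eqxx.
    have -> : (B *m G) i1 (f i1) = (row i1 B *m G) ord0 (f i1) by rewrite -row_mul [RHS]mxE.
    by rewrite r0 mul0mx mxE => /esym/eqP; rewrite oner_eq0.
  have := mG _ nzr; apply/negP; rewrite -leqNgt.
  have cjZ : #|j |: Z| = k.+2 by rewrite cardsU1 jZ cZ.
  rewrite -[X in (X <= _)%N]cjZ; apply: subset_leq_card; apply/subsetP => l.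
  rewrite !inE -row_mul [(row _ _) _ _]mxE.
  case/orP => [/eqP->|/imsetP[i]]; first by rewrite e.
  by rewrite !inE => ni ->; rewrite sysE (eq_sym i1) (negbTE ni).
apply: (@leq_trans (\sum_(a : 'F_p) Fp_lee_vec (x a *m B *m G)%R)%N).
  have -> : (d * p = \sum_(a : 'F_p) d)%N by rewrite sum_nat_const card_Fp // mulnC.
  by apply: leq_sum => a _; apply: le_d.
rewrite /Fp_lee_vec exchange_big /=.
apply: (@leq_trans (\sum_(j < n) ((j == f i0) * p + (j \notin Z) * Fp_lee_sum p))%N).
  apply: leq_sum => j _; rewrite (eq_bigr (fun a => Fp_lee (g a j))) //.
  case jZ: (j \in Z) => /=; last first.
    rewrite (eq_bigr (fun a => Fp_lee ((B *m G) i0 j + a * (B *m G) i1 j))).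
      by rewrite Fp_lee_sum_affine ?mul1n ?leq_addl // nzBG ?jZ.
    by move=> a _; rewrite gE.
  rewrite mul0n addn0; case/imsetP: jZ => i; rewrite !inE => ni ->.
  rewrite (eq_bigr (fun=> Fp_lee ((i0 == i)%:R : 'F_p))); last first.
    by move=> a _; rewrite gE !sysE (eq_sym i1) (negbTE ni) mulr0 addr0.
  rewrite sum_nat_const card_Fp // (inj_eq injf) (eq_sym i0) mulnC.
  by case: (i == i0); rewrite ?Fp_lee0 ?Fp_lee1 ?mul0n.
rewrite big_split /= -!big_distrl /= -!big_mkcond /= !sum1_card.
have -> : #|[pred j | j == f i0]| = 1%N by rewrite card1.
have -> : #|[pred j | j \notin Z]| = (n - k.+1)%N.
  have := cardsC Z; rewrite cZ card_ord => e.
  have -> : #|[pred j | j \notin Z]| = #|~: Z| by apply: eq_card => j; rewrite !inE.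
  by move: e; clear; lia.
by rewrite mul1n.
Qed.

Lemma full_code_lee_le (p k d : nat) (G : 'M['F_p]_k.+1) : prime p ->
  row_free G -> (forall u, u != 0 -> (d <= Fp_lee_vec (u *m G))%N) -> (d <= 1)%N.
Proof.
move=> p_pr fG le_d.
have uG : G \in unitmx by rewrite -row_free_unit.
pose e : 'rV['F_p]_k.+1 := delta_mx ord0 ord0.
have nze : e *m invmx G != 0.
  apply/eqP => e0; have : e = 0 by rewrite -(mulmxKV uG e) e0 mul0mx.
  by move/matrixP => /(_ ord0 ord0)/eqP; rewrite !mxE !eqxx oner_eq0.
apply: leq_trans (le_d _ nze) _; rewrite mulmxKV // /Fp_lee_vec.
rewrite (bigD1 ord0) //= big1 ?addn0 => [|j nj]; rewrite !mxE ?eqxx ?Fp_lee1 //.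
by rewrite (negbTE nj) Fp_lee0.
Qed.

(** * Reduction to the prime field: the words killed by [p] *)

Lemma min_lee_distance_le (q n : nat) (C : {set 'rV['Z_q]_n}) c :
  c \in C -> c != 0 -> (min_lee_distance C <= lee_weight_vec c)%N.
Proof.
move=> cC nzc; rewrite /min_lee_distance; case: pickP => [c0 c0P|/(_ c)]; last first.
  by rewrite cC nzc.
by case: arg_minnP => // c1 _; apply; rewrite cC nzc.
Qed.

Lemma Zp_natr_eq (m a b : nat) : (1 < m)%N ->
  (a%:R == b%:R :> 'Z_m) = (a == b %[mod m]).
Proof.
move=> m_gt1; rewrite -(inj_eq val_inj) /=.
by rewrite !(val_Zp_nat m_gt1).
Qed.

Lemma val_ZpD (m : nat) (a b : 'Z_m) : (1 < m)%N ->
  nat_of_ord (a + b) = ((a + b) %% m)%N.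
Proof. by move=> m_gt1; apply: (congr1 (modn (a + b)) (Zp_cast m_gt1)). Qed.

Lemma val_FpD (p : nat) (a b : 'F_p) : prime p ->
  nat_of_ord (a + b) = ((a + b) %% p)%N.
Proof. by move=> p_pr; apply: (congr1 (modn (a + b)) (Fp_cast p_pr)). Qed.

Lemma Zp_add_scale (d q : nat) (a b : 'Z_d) : (1 < d)%N -> (0 < q)%N ->
  ((a + b : 'Z_d)%R * q)%:R = (a * q)%:R + (b * q)%:R :> 'Z_(d * q).
Proof.
move=> d_gt1 q_gt0; rewrite -natrD -mulnDl; apply/eqP.
rewrite Zp_natr_eq; last by nia.
by rewrite val_ZpD // muln_modl // modn_mod.
Qed.

Lemma Zp_ltn (m : nat) (a : 'Z_m) : (1 < m)%N -> (a < m)%N.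
Proof. by move=> m_gt1; have := ltn_ord a; rewrite [X in (_ < X)%N]Zp_cast. Qed.

Lemma Fp_ltn (p : nat) (a : 'F_p) : prime p -> (a < p)%N.
Proof. by move=> p_pr; have := ltn_ord a; rewrite [X in (_ < X)%N]Fp_cast. Qed.

Section Socle.
Variables (p t n : nat) (k : 'I_t -> nat).
Hypotheses (p_pr : prime p) (t_gt0 : (0 < t)%N).
Variables (C : {set 'rV['Z_(p ^ t)]_n}) (f : code_model p k -> 'rV['Z_(p ^ t)]_n).
Hypothesis fD : forall x y, f (fun i => x i + y i) = f x + f y.
Hypothesis f_inj : injective f.
Hypothesis f_im : forall v, v \in C <-> exists x, f x = v.

Let K := (\sum_(i < t) k i)%N.
Let q := (p ^ (t - 1))%N.

(** Identifies the prime field with the elements killed by [p] in [Z_(p^(t-i))], the multiples of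
    [p ^ (t - i - 1)]; [submxrow u i] is the block of [u] for factor [i]. *)
Let lift_socle (u : 'rV['F_p]_K) : code_model p k := fun i =>
  \row_j (submxrow u i ord0 j * p ^ (t - i - 1))%:R.

Let phi u := f (lift_socle u).

Lemma exp_gt1 e : (0 < e)%N -> (1 < p ^ e)%N.
Proof. by move=> e_gt0; rewrite -(exp1n e) ltn_exp2r // prime_gt1. Qed.

Lemma socleD u v : phi (u + v) = phi u + phi v.
Proof.
rewrite /phi -fD; congr f; apply: functional_extensionality_dep => i.
have it : (0 < t - i)%N by rewrite subn_gt0.
apply/rowP => j; rewrite !mxE.
set a := u _ _; set b := v _ _.
rewrite -natrD -mulnDl; apply/eqP; rewrite Zp_natr_eq ?exp_gt1 //.
have -> : (p ^ (t - i) = p * p ^ (t - i - 1))%N by rewrite -expnS; congr (p ^ _)%N; lia.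
rewrite val_FpD // muln_modl ?expn_gt0 ?prime_gt0 //.
by rewrite modn_mod.
Qed.

Lemma socle0 : phi 0 = 0.
Proof. by apply: (addrI (phi 0)); rewrite -socleD !addr0. Qed.

Lemma socleMn u m : phi (u *+ m) = phi u *+ m.
Proof. by elim: m => [|m IHm]; rewrite ?mulr0n ?socle0 // !mulrS socleD IHm. Qed.

(** [phi u] is killed by [p] because [u] is. *)
Lemma socle_dvd u l : (q %| phi u ord0 l)%N.
Proof.
have p0 : (p%:R : 'F_p) = 0 by apply: pcharf0; apply: pchar_Fp.
have : phi u *+ p = 0.
  by rewrite -socleMn -scaler_nat p0 scale0r socle0.
move/matrixP => /(_ ord0 l); rewrite mulmxnE mxE.
rewrite -[phi u ord0 l]natr_Zp -mulrnA => /eqP.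
rewrite -[0]/(0%:R) Zp_natr_eq ?exp_gt1 // natr_Zp mod0n.
move: (nat_of_ord _) => m.
have -> : (p ^ t = q * p)%N by rewrite -expnSr; congr (p ^ _)%N; lia.
by rewrite -/(dvdn _ _) dvdn_pmul2r ?prime_gt0.
Qed.

Let psi u : 'rV['F_p]_n := \row_l (phi u ord0 l %/ q)%:R.

Lemma q_gt0 : (0 < q)%N. Proof. by rewrite expn_gt0 prime_gt0. Qed.

Lemma pt_qp : (p ^ t = p * q)%N.
Proof. by rewrite -expnS; congr (p ^ _)%N; lia. Qed.

Lemma socle_val u l : (phi u ord0 l : nat) = (psi u ord0 l * q)%N.
Proof.
rewrite mxE val_Fp_nat // modn_small ?divnK ?socle_dvd //.
by rewrite ltn_divLR ?q_gt0 // -pt_qp Zp_ltn // exp_gt1.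
Qed.

Lemma socle_coordD u v : psi (u + v) = psi u + psi v.
Proof.
apply/rowP => l; apply: ord_inj; apply/eqP.
rewrite -(eqn_pmul2r q_gt0) -socle_val socleD [(phi u + phi v) _ _]mxE.
rewrite [(psi u + psi v) _ _]mxE val_FpD // val_ZpD ?exp_gt1 //.
rewrite muln_modl ?q_gt0 // mulnDl -!socle_val.
by rewrite -pt_qp.
Qed.

Lemma socle_coord_linear : linear psi.
Proof.
move=> a u v; rewrite socle_coordD; congr (_ + _).
have psi0 : psi 0 = 0 by apply: (addrI (psi 0)); rewrite -socle_coordD !addr0.
rewrite -[a]natr_Zp !scaler_nat.
elim: (a : nat) => [|m IHm]; first by rewrite !mulr0n.
by rewrite !mulrS socle_coordD IHm.
Qed.

Lemma lift_socle_inj u : lift_socle u = lift_socle 0 -> u = 0.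
Proof.
move=> eq_u; rewrite -[u]submxrowK -[0]submxrowK; apply/eq_mxrowP => i.
apply/rowP => j; have it : (0 < t - i)%N by rewrite subn_gt0.
have := congr1 (fun x => x i) eq_u => /rowP/(_ j); rewrite !mxE /=.
move/eqP; rewrite Zp_natr_eq ?exp_gt1 // mul0n mod0n.
set a := u _ _.
have -> : (p ^ (t - i) = p * p ^ (t - i - 1))%N by rewrite -expnS; congr (p ^ _)%N; lia.
rewrite -/(dvdn _ _) dvdn_pmul2r ?expn_gt0 ?prime_gt0 // => pa.
apply: val_inj => /=; apply/eqP; rewrite -leqn0 leqNgt; apply/negP => a_gt0.
by have := dvdn_leq a_gt0 pa; rewrite leqNgt Fp_ltn.
Qed.

(** [G] is the matrix of [psi], and the word for [u] is [phi u]. In [Z_(pq)] the Lee weight of [q a]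
    is the minimum of [q a] and [p q - q a], which is [q] times that of [a] mod [p]. *)
Lemma socle_matrix : exists G : 'M['F_p]_(K, n), row_free G /\
  forall u, u != 0 -> exists c, [/\ c \in C, c != 0 &
    lee_weight_vec c = (q * Fp_lee_vec (u *m G))%N].
Proof.
pose L : {linear 'rV['F_p]_K -> 'rV['F_p]_n} :=
  HB.pack psi (GRing.isLinear.Build _ _ _ _ psi socle_coord_linear).
have GE u : u *m lin1_mx L = psi u by rewrite mul_rV_lin1.
have phi_neq0 u : u != 0 -> phi u != 0.
  apply: contra => /eqP phi0; apply/eqP/lift_socle_inj/f_inj.
  by rewrite -/(phi u) -/(phi 0) phi0 socle0.
exists (lin1_mx L); split.
  rewrite -kermx_eq0; apply/eqP/row_matrixP => i; rewrite row0.
  apply/eqP/negPn/negP => nz; have := phi_neq0 _ nz; apply/negP/negPn/eqP.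
  apply/rowP => l; apply: ord_inj; rewrite socle_val.
  by rewrite -GE -row_mul mulmx_ker row0 !mxE.
move=> u nzu; exists (phi u); split.
- by apply/f_im; exists (lift_socle u).
- exact: phi_neq0.
rewrite /lee_weight_vec /Fp_lee_vec big_distrr /=; apply: eq_bigr => l _.
by rewrite GE /lee_weight /Fp_lee socle_val pt_qp -mulnBl -minnMl mulnC.
Qed.
End Socle.

Lemma Phi_le (p t n K : nat) (X : int) : prime p -> (0 < t)%N ->
    (0 < K <= n)%N ->
    (forall d (G : 'M['F_p]_(K, n)), row_free G ->
       (forall u, u != 0 -> (d <= Fp_lee_vec (u *m G))%N) -> d%:Z <= X) ->
  (Phi n K p t)%:Z <= (p ^ (t - 1))%N%:Z * X.
Proof.
move=> p_pr t_gt0 /andP[K_gt0 le_Kn] bound.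
(* The case [d = 0] for some row free [G] gives the sign of [X], which can then be handled as a
   natural number. *)
have X_ge0 : 0 <= X.
  apply: (bound 0%N (pid_mx K)) => //.
  by rewrite /row_free rank_pid_mx.
rewrite -(gez0_abs X_ge0) -PoszM lez_nat; apply/bigmax_leqP => C /asboolP[_].
case=> k [f [fD _ f_inj f_im]] KE.
have [G [fG Gval]] := socle_matrix p_pr t_gt0 fD f_inj f_im.
rewrite -KE in G fG Gval.
pose u0 : 'rV['F_p]_K := delta_mx ord0 (Ordinal K_gt0).
have nzu0 : u0 != 0.
  by apply/eqP => /rowP/(_ (Ordinal K_gt0))/eqP; rewrite !mxE !eqxx oner_eq0.
have [u nzu min_u] := @arg_minnP _ u0 (fun u => u != 0) (fun u => Fp_lee_vec (u *m G)) nzu0.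
have [c [cC nzc cE]] := Gval u nzu.
apply: leq_trans (min_lee_distance_le cC nzc) _; rewrite cE leq_mul2l.
apply/orP; right; rewrite -lez_nat gez0_abs //; apply: bound fG _ => v nzv.
exact: min_u.
Qed.

(** * A code of distance [p ^ (t - 1)] for [n = K] *)

Section TopCode.
Variables (p t K : nat).
Hypotheses (p_pr : prime p) (t_gt0 : (0 < t)%N).

Let q := (p ^ (t - 1))%N.
Let top_code : {set 'rV['Z_(p ^ t)]_K.+1} :=
  [set v : 'rV['Z_(p ^ t)]_K.+1 | [forall l, (q %| v ord0 l)%N]].

Let pt_gt1 : (1 < p ^ t)%N. Proof. exact: exp_gt1. Qed.
Let ptE : (p ^ t = p * q)%N. Proof. by rewrite -expnS; congr (p ^ _)%N; lia. Qed.

Lemma top_code_linear : linear_code top_code.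
Proof.
have dvd_modq m : (q %| m %% p ^ t)%N = (q %| m)%N.
  by rewrite /dvdn modn_dvdm // ptE dvdn_mull.
split; first by rewrite inE; apply/forallP => l; rewrite mxE dvdn0.
move=> a u v; rewrite !inE => /forallP du /forallP dv; apply/forallP => l.
rewrite 2!mxE val_ZpD // dvd_modq dvdn_add ?dv //.
rewrite -[a * _]natr_Zp val_Zp_nat // dvd_modq.
have -> : nat_of_ord (a * u ord0 l) = ((a * u ord0 l) %% p ^ t)%N.
  exact: (congr1 (modn (a * u ord0 l)) (Zp_cast pt_gt1)).
by rewrite dvd_modq dvdn_mull ?du.
Qed.

(** If [q] divides a nonzero residue [a], it also divides [p ^ t - a > 0], so both are at least
    [q]. *)
Lemma top_code_distance : (q <= min_lee_distance top_code)%N.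
Proof.
have q_gt0 : (0 < q)%N by rewrite expn_gt0 prime_gt0.
have q_lt : (q < p ^ t)%N by rewrite ptE ltn_Pmull ?prime_gt1.
(* The constant word [q] excludes the placeholder value of the zero code. *)
rewrite /min_lee_distance; case: pickP => [c0 c0P|none]; last first.
  have := none (const_mx q%:R); rewrite inE.
  have -> : [forall l, (q %| (const_mx q%:R : 'rV['Z_(p ^ t)]_K.+1) ord0 l)%N].
    by apply/forallP => l; rewrite mxE val_Zp_nat // modn_small.
  move=> /negbT/negPn/eqP/rowP/(_ ord0)/(congr1 (@nat_of_ord _)).
  by rewrite !mxE val_Zp_nat // modn_small // => q0; move: q_gt0; rewrite q0.
case: arg_minnP => // c /andP[]; rewrite inE => /forallP dc nzc _.
have [l nzl] : exists l, c ord0 l != 0.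
  apply/existsP; rewrite -negb_forall; apply: contra nzc => /forallP c0'.
  by apply/eqP/rowP => l; rewrite mxE; apply/eqP.
rewrite /lee_weight_vec (bigD1 l) //=; apply: leq_trans (leq_addr _ _).
have cl_gt0 : (0 < c ord0 l)%N by rewrite lt0n.
have cl_lt := Zp_ltn (c ord0 l) pt_gt1.
rewrite /lee_weight leq_min (dvdn_leq cl_gt0 (dc l)) dvdn_leq ?subn_gt0 //.
by rewrite dvdn_sub ?dc // ptE dvdn_mull.
Qed.

Lemma top_code_rank : has_rank top_code K.+1.
Proof.
have lt_t1 : (t - 1 < t)%N by lia.
pose i0 : 'I_t := Ordinal lt_t1.
(* Only the last factor [Z_p], of index [t - 1], occurs; the other blocks are empty. *)
pose k (i : 'I_t) := if i == i0 then K.+1 else 0%N.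
have ki0 : k i0 = K.+1 by rewrite /k eqxx.
have kN i (j : 'I_(k i)) : i = i0.
  by apply/eqP; move: j; rewrite /k; case: eqP => // _ [].
have q_gt0 : (0 < p ^ i0)%N by rewrite expn_gt0 prime_gt0.
have pi0 : (p ^ (t - i0) * p ^ i0 = p ^ t)%N by rewrite -expnD subnK // ltnW.
have pi_gt1 : (1 < p ^ (t - i0))%N by apply: exp_gt1 => //; rewrite subn_gt0.
pose f (x : code_model p k) : 'rV['Z_(p ^ t)]_K.+1 :=
  \row_l (x i0 ord0 (cast_ord (esym ki0) l) * p ^ i0)%:R.
have fD x y : f (fun i => x i + y i) = f x + f y.
  apply/rowP => l; rewrite !mxE.
  by have := Zp_add_scale (x i0 ord0 (cast_ord (esym ki0) l))
               (y i0 ord0 (cast_ord (esym ki0) l)) pi_gt1 q_gt0; rewrite pi0.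
have f0 : f (fun i => 0) = 0 by apply/rowP => l; rewrite !mxE mul0n.
exists k; last first.
  rewrite (bigD1 i0) //= ki0 big1 ?addn0 // => i ni.
  by rewrite /k (negbTE ni).
exists f; split => //.
- move=> a x; rewrite -[in RHS](natr_Zp a) scaler_nat.
  elim: (nat_of_ord a) => [|m IHm]; first by rewrite mulr0n -f0.
  rewrite mulrS -IHm -fD; congr f; apply: functional_extensionality_dep => i.
  by rewrite mulrS.
- move=> x y /rowP fxy; apply: functional_extensionality_dep => i.
  apply/rowP => j; have ei := kN i j; move: j; rewrite ei => j.
  have := fxy (cast_ord ki0 j); rewrite !mxE cast_ordK.
  move/eqP; rewrite Zp_natr_eq // !modn_small; last 2 first.
  + by rewrite -pi0 ltn_pmul2r // Zp_ltn.
  + by rewrite -pi0 ltn_pmul2r // Zp_ltn.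
  by rewrite eqn_pmul2r // => /eqP/ord_inj.
move=> v; rewrite inE; split.
  move=> /forallP dv; pose x : code_model p k := fun i =>
    \row_j (v ord0 (inord j) %/ q)%:R.
  exists x; apply/rowP => l; rewrite !mxE /= inord_val val_Zp_nat //.
  rewrite modn_small ?divnK ?dv ?natr_Zp //.
  rewrite ltn_divLR; last exact: q_gt0.
  by have := Zp_ltn (v ord0 l) pt_gt1; rewrite -[X in (_ < X)%N]pi0.
case=> x <-; apply/forallP => l; rewrite mxE val_Zp_nat //.
by rewrite /dvdn modn_dvdm ?ptE ?dvdn_mull // -/(dvdn _ _) dvdn_mull.
Qed.

Lemma Phi_diag_ge : (q <= Phi K.+1 K.+1 p t)%N.
Proof.
apply: leq_trans top_code_distance _; apply: leq_bigmax_cond.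
by apply/asboolP; split; [exact: top_code_linear | exact: top_code_rank].
Qed.
End TopCode.

(** * Assembling the four bounds *)

Lemma mdsVlow_weight (F : finFieldType) (k n : nat) (G : 'M[F]_(k, n)) :
  mds G \/ exists2 u, u != 0 & (hamming_weight (u *m G) <= n - k)%N.
Proof.
have [/existsP[u /andP[nzu le_k]]|none] :=
  boolP [exists u : 'rV_k, (u != 0) && (k <= #|[set j | (u *m G) ord0 j == 0%R]|)%N].
  right; exists u => //; rewrite -[X in (_ <= X - _)%N](card_zeros (u *m G)).
  by rewrite addnC -addnBA // leq_addr.
left=> u nzu; rewrite ltnNge; apply: contra none => le_k.
by apply/existsP; exists u; rewrite nzu.
Qed.

Lemma lee_le_mu_hamming (p k n d : nat) (G : 'M['F_p]_(k, n)) u : prime p ->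
    (forall u, u != 0 -> (d <= Fp_lee_vec (u *m G))%N) -> u != 0 ->
  d%:R <= mu p * (hamming_weight (u *m G))%:R.
Proof.
move=> p_pr le_d nzu; have := lee_le_hamming p_pr le_d nzu.
rewrite mu_Fp_lee_sum // mulrAC ler_pdivlMr; last first.
  by rewrite ltr0n subn_gt0 prime_gt1.
by rewrite -!natrM ler_nat [X in (_ <= X)%N]mulnC.
Qed.

Lemma mu_ge0 (p : nat) : 0 <= mu p.
Proof. by rewrite /mu divr_ge0. Qed.

Lemma floor_ge_nat (d : nat) (x : rat) : d%:R <= x -> d%:Z <= Num.floor x.
Proof. by move=> le_dx; rewrite floor_ge_int. Qed.

Theorem theorem23 (p t K : nat) (p_prime : prime p) (t_ge1 : (1 <= t)%N)
    (K_ge2 : (2 <= K)%N) :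
  [/\ forall n : nat, (K <= n)%N ->
        (Phi n K p t)%:Z <=
          (p ^ (t - 1))%N%:Z *
          Num.floor (mu p * ((n - K + 1)%N%:R
                             - (Num.floor ((n - K + 1)%N%:R / (p + 1)%N%:R
                                           : rat))%:~R)),
      forall n : nat,
        ((p <= K)%N /\ (K + 1 < n)%N) \/ ((2 <= K <= p)%N /\ (p + 1 < n)%N) ->
        (Phi n K p t)%:Z <=
          (p ^ (t - 1))%N%:Z * Num.floor (mu p * (n - K)%N%:R),
      forall n : nat, (3 <= K + 1)%N -> (K + 1 <= n)%N -> (n <= p + 1)%N ->
        (Phi n K p t)%:Z <=
          (p ^ (t - 1))%N%:Z *
          Num.floor (mu p * (n - K + 1)%N%:R * ((p - 1)%N%:R / p%:R) + 1)
    & Phi K K p t = (p ^ (t - 1))%N ].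
Proof.
case: K K_ge2 => [|[|k]] // _; have p_gt1 := prime_gt1 p_prime.
have cardF := card_Fp p_prime; have charF := pchar_Fp p_prime.
split.
- move=> n le_Kn; apply: Phi_le => // d G fG le_d; apply: floor_ge_nat.
  pose u0 : 'rV['F_p]_k.+2 := delta_mx ord0 ord0.
  have nzu0 : u0 != 0.
    by apply/eqP => /rowP/(_ ord0)/eqP; rewrite !mxE !eqxx oner_eq0.
  have [u nzu min_u] := @arg_minnP _ u0 (fun u => u != 0)
                          (fun u => hamming_weight (u *m G)) nzu0.
  apply: le_trans (lee_le_mu_hamming p_prime le_d nzu) _.
  apply: ler_wpM2l; first exact: mu_ge0.
  (* With [M = n - K + 1] this says [w (p + 1) <= (M + 1) p]; since [w] is an integer,
     [w <= M - floor (M / (p + 1))]. *)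
  have := two_dim_plotkin fG (fun v => min_u v); rewrite cardF.
  set w := hamming_weight _; set x := (_ / _ : rat) => le_w.
  have : (Num.floor x)%:~R <= x by apply: ge_floor.
  rewrite /x ler_pdivlMr ?ltr0n ?addn1 //; move: (Num.floor _) => z.
  rewrite -[_.+1%:R]/(_.+1%:Z%:~R) -[(_ - _).+1%:R]/((_ - _).+1%:Z%:~R).
  rewrite -[w%:R]/(w%:Z%:~R) -intrM -intrB !ler_int.
  by move: le_w le_Kn; clear; nia.
(* Both alternatives of (B) give [n >= K + 2] and [n >= p + 2], which exclude MDS codes, so some
   nonzero word has weight at most [n - K]. *)
- move=> n Kn; have [le_Kn n_gt] : (k.+4 <= n)%N /\ (p.+1 < n)%N by lia.
  apply: Phi_le => //; first by lia.
  move=> d G fG le_d; apply: floor_ge_nat.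
  have [mG|[u nzu le_w]] := mdsVlow_weight G.
    have := mds_prime_length p_prime cardF charF (isT : 2 <= k.+2)%N le_Kn mG.
    by rewrite leqNgt n_gt.
  apply: le_trans (lee_le_mu_hamming p_prime le_d nzu) _.
  by apply: ler_wpM2l; rewrite ?mu_ge0 // ler_nat.
- move=> n _ lt_Kn le_np; apply: Phi_le => //; first by lia.
  move=> d G fG le_d; apply: floor_ge_nat.
  have p_gt0 : (0 : rat) < p%:R by rewrite ltr0n prime_gt0.
  have p1_gt0 : (0 : rat) < (p - 1)%N%:R by rewrite ltr0n subn_gt0.
  have [mG|[u nzu le_w]] := mdsVlow_weight G.
    have le_Kn : (k.+2 <= n)%N by lia.
    have := mds_lee_le p_prime le_Kn mG le_d; rewrite mu_Fp_lee_sum //.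
    have -> : (n - k.+1 = n - k.+2 + 1)%N by lia.
    move: (Fp_lee_sum p) (n - k.+2 + 1)%N => S M le_dp.
    have -> : S%:R / (p - 1)%N%:R * M%:R * ((p - 1)%N%:R / p%:R) + 1 =
              (p + M * S)%N%:R / p%:R :> rat.
      by rewrite natrD natrM; field; rewrite !gt_eqF.
    by rewrite ler_pdivlMr // -natrM ler_nat.
  (* For a non-MDS code, weight at most [n - K] suffices: [(n - K) p <= (n - K + 1) (p - 1)] because
     [n - K <= p - 1]. *)
  apply: le_trans (lee_le_mu_hamming p_prime le_d nzu) _.
  apply: ler_wpDr => //; rewrite -mulrA; apply: ler_wpM2l; first exact: mu_ge0.
  rewrite mulrA ler_pdivlMr // -!natrM ler_nat.
  apply: leq_trans (leq_mul le_w (leqnn p)) _.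
  by move: p_gt1 lt_Kn le_np; clear; nia.
apply/eqP; rewrite eqn_leq Phi_diag_ge // andbT.
(* The bound 1 holds over the prime field, where the code is the whole space and contains unit
   vectors. *)
rewrite -lez_nat -[X in _ <= X]mulr1; apply: Phi_le => //; first by lia.
by move=> d G fG le_d; rewrite lez_nat; apply: full_code_lee_le fG le_d.
Qed.
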